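(* Let $\rho_1,\dots,\rho_N$ be pairwise orthogonal density operators on $\mathbb C^2\otimes\mathbb C^2$ shared by two parties. Then $\{\rho_1,\dots,\rho_N\}$ is perfectly distinguishable by LOCC if and only if $\sum_{k=1}^N\mathrm{Sch}_\perp(\rho_k)\le4$.
   Context: For a bipartite state $\rho$, $\mathrm{Sch}_\perp(\rho)$ (orthogonal Schmidt number) is the minimal number of pairwise orthogonal product vectors $|a\rangle\otimes|b\rangle$ whose span contains $\mathrm{Supp}(\rho)$, the span of the eigenvectors of $\rho$ with positive eigenvalues. ''Perfectly distinguishable by LOCC'': there is a finite-round protocol of local measurements with broadcast outcomes that identifies the given state with probability 1. States are orthogonal if $\mathrm{tr}(\rho_k\rho_l)=0$. *)

(* Defs.v *)
From HB Require Import structures.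
From mathcomp Require Import all_boot all_order all_algebra.
From Stdlib Require Import ClassicalEpsilon.
Set Implicit Arguments. Unset Strict Implicit. Unset Printing Implicit Defensive.
Import Order.TTheory GRing.Theory Num.Theory.
Local Open Scope ring_scope.

Lemma tens_pos m n i : (i < m * n)%N -> (0 < n)%N.
Proof. by case: n => //; rewrite muln0. Qed.

Lemma tens_idx1P m n (i : 'I_(m * n)) : (i %/ n < m)%N.
Proof. by rewrite ltn_divLR ?(tens_pos (ltn_ord i)) // ltn_ord. Qed.

Lemma tens_idx2P m n (i : 'I_(m * n)) : (i %% n < n)%N.
Proof. by rewrite ltn_mod (tens_pos (ltn_ord i)). Qed.

Definition tens_idx1 m n (i : 'I_(m * n)) : 'I_m := Ordinal (tens_idx1P i).
Definition tens_idx2 m n (i : 'I_(m * n)) : 'I_n := Ordinal (tens_idx2P i).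

Section Quantum.
Variable C : numClosedFieldType.

Definition tensmx m1 n1 m2 n2 (A : 'M[C]_(m1, n1)) (B : 'M[C]_(m2, n2))
  : 'M[C]_(m1 * m2, n1 * n2) :=
  \matrix_(i, j) (A (tens_idx1 i) (tens_idx1 j) * B (tens_idx2 i) (tens_idx2 j)).

Definition adjmx m n (A : 'M[C]_(m, n)) : 'M[C]_(n, m) := (map_mx Num.conj A)^T.

Definition inner n (u v : 'cV[C]_n) : C := (adjmx u *m v) 0 0.

Definition psd n (A : 'M[C]_n) : Prop := forall x : 'cV[C]_n, 0 <= inner x (A *m x).

Definition density n (rho : 'M[C]_n) : Prop :=
  adjmx rho = rho /\ psd rho /\ \tr rho = 1.

Definition in_supp n (rho : 'M[C]_n) (v : 'cV[C]_n) : Prop :=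
  exists (m : nat) (lam : 'I_m -> C) (w : 'I_m -> 'cV[C]_n),
    (forall i, 0 < lam i /\ rho *m w i = lam i *: w i) /\ v = \sum_i w i.

Definition orth_prod_cover (rho : 'M[C]_(2 * 2)) (m : nat) : Prop :=
  exists (a b : 'I_m -> 'cV[C]_2),
    (forall i j, i != j -> inner (tensmx (a i) (b i)) (tensmx (a j) (b j)) = 0) /\
    (forall v, in_supp rho v ->
       exists c : 'I_m -> C, v = \sum_i c i *: tensmx (a i) (b i)).

Definition Sch_perp (rho : 'M[C]_(2 * 2)) : nat :=
  epsilon (inhabits 0%N)
    (fun m => orth_prod_cover rho m /\ forall k, orth_prod_cover rho k -> (m <= k)%N).

End Quantum.

(* ---------- finite-round LOCC protocols ----------
   A protocol tree.  At each internal node one party (Alice or Bob) applies a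
   local instrument given by Kraus operators K_i : C^da -> C^dout (i < m), the
   outcome i is broadcast, and the protocol continues with subtree next i
   (with Alice's / Bob's local dimension possibly changed).  Leaves carry the
   guessed label (an index; labels >= N are simply wrong guesses, which
   also makes the degenerate case N = 0 behave correctly).  Trees are finite, so protocols are finite-round. *)
Inductive protocol (C : numClosedFieldType) (N : nat) : nat -> nat -> Type :=
| Leaf : forall da db, nat -> protocol C N da db
| AStep : forall da db (m dout : nat),
    ('I_m -> 'M[C]_(dout, da)) -> ('I_m -> protocol C N dout db) ->
    protocol C N da db
| BStep : forall da db (m dout : nat),
    ('I_m -> 'M[C]_(dout, db)) -> ('I_m -> protocol C N da dout) ->
    protocol C N da db.

Fixpoint valid_protocol (C : numClosedFieldType) (N : nat) da db
  (p : protocol C N da db) {struct p} : Prop :=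
  match p with
  | Leaf _ _ _ => True
  | AStep da db m dout K next =>
      \sum_(i < m) (adjmx (K i) *m K i) = 1%:M /\
      forall i, valid_protocol (next i)
  | BStep da db m dout K next =>
      \sum_(i < m) (adjmx (K i) *m K i) = 1%:M /\
      forall i, valid_protocol (next i)
  end.

(* [identifies p sigma k]: running p on the (unnormalised) state sigma, every
   leaf reached with nonzero probability (trace of the unnormalised
   post-measurement state) carries the label k. *)
Fixpoint identifies (C : numClosedFieldType) (N : nat) da db
  (p : protocol C N da db) (sigma : 'M[C]_(da * db)) (k : 'I_N) {struct p} : Prop :=
  match p in protocol _ _ da db return 'M[C]_(da * db) -> Prop with
  | Leaf _ _ l => fun sigma => \tr sigma = 0 \/ l = nat_of_ord k
  | AStep da db m dout K next => fun sigma =>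
      forall i, identifies (next i)
        (tensmx (K i) (1%:M : 'M[C]_db) *m sigma *m adjmx (tensmx (K i) (1%:M : 'M[C]_db))) k
  | BStep da db m dout K next => fun sigma =>
      forall i, identifies (next i)
        (tensmx (1%:M : 'M[C]_da) (K i) *m sigma *m adjmx (tensmx (1%:M : 'M[C]_da) (K i))) k
  end sigma.

Definition LOCC_perfectly_distinguishable (C : numClosedFieldType) (N : nat)
  (rho : 'I_N -> 'M[C]_(2 * 2)) : Prop :=
  exists p : protocol C N 2 2,
    valid_protocol p /\ forall k, identifies p (rho k) k.

(* Main.v *)
(* Write rho_k = X_k X_k^*, so that supp rho_k is the column space of X_k. Both
   sides are equivalent to the existence of a local labelling: an orthonormal
   basis a_i (x) b_ij, with the a_i measured first by one of the parties, and a
   label for each (i, j) such that a_i (x) b_ij is orthogonal to supp rho_k unless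
   its label is k. Measuring it is an LOCC protocol, and counting the four labels
   bounds the sum of the Sch_perp.
   LOCC -> labelling: until some effect E is nonscalar the parties only apply
   local isometries; E preserves orthogonality, hence so do its two spectral
   projections, which are combinations of E and 1, and the conditional
   states on the other qubit are pairwise orthogonal.
   Bound -> labelling: each Sch_perp is at least 1, so N <= 4. Two orthogonal
   product vectors have orthogonal factors on one side, and their complement is
   again spanned by two such vectors; this settles all cases but two. For four
   product vectors, orthogonality on Alice's and on Bob's side are triangle-free
   relations covering the edges of K4, so one of them contains a 4-cycle. For two
   pure states (Walgate et al.), use that a traceless 2 x 2 matrix has zero
   diagonal in some orthonormal basis. *)
Require Import Defs.
From HB Require Import structures.
From mathcomp Require Import all_boot all_order all_algebra.
From mathcomp Require Import ring zify.
From mathcomp Require mxtens.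
From Stdlib Require Import ClassicalEpsilon.
Set Implicit Arguments. Unset Strict Implicit. Unset Printing Implicit Defensive.
Import Order.TTheory GRing.Theory Num.Theory.
Local Open Scope ring_scope.
Local Open Scope sesquilinear_scope.

(** * Adjoints, inner products and the spectral theorem *)

Section Adjoint.
Variable C : numClosedFieldType.

Lemma adjmxE m n (A : 'M[C]_(m, n)) : adjmx A = A ^t*.
Proof. by rewrite /adjmx map_trmx. Qed.

Lemma adjmxK m n (A : 'M[C]_(m, n)) : adjmx (adjmx A) = A.
Proof. by apply/matrixP => i j; rewrite !mxE conjCK. Qed.

Lemma adjmxM m n p (A : 'M[C]_(m, n)) (B : 'M[C]_(n, p)) :
  adjmx (A *m B) = adjmx B *m adjmx A.
Proof. by rewrite /adjmx map_mxM trmx_mul. Qed.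

Lemma adjmx0 m n : adjmx (0 : 'M[C]_(m, n)) = 0.
Proof. by rewrite /adjmx map_mx0 trmx0. Qed.

Lemma adjmx1 n : adjmx (1%:M : 'M[C]_n) = 1%:M.
Proof. by rewrite /adjmx map_mx1 trmx1. Qed.

Lemma adjmxZ m n c (A : 'M[C]_(m, n)) : adjmx (c *: A) = c^* *: adjmx A.
Proof. by rewrite /adjmx map_mxZ linearZ. Qed.

Lemma adjmx_mulCmx m n p (A : 'M[C]_(m, n)) (B : 'M[C]_(m, p)) :
  adjmx A *m B = 0 -> adjmx B *m A = 0.
Proof. by move=> h; rewrite -[LHS]adjmxK adjmxM adjmxK h adjmx0. Qed.

(** This trace is the sum of the squared moduli of the entries of [A]. *)
Lemma mxtrace_mulmx_adj_eq0 m n (A : 'M[C]_(m, n)) :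
  \tr (A *m adjmx A) = 0 -> A = 0.
Proof.
have tE i : (A *m adjmx A) i i = \sum_j `|A i j| ^+ 2.
  by rewrite mxE; apply: eq_bigr => j _; rewrite !mxE normCK.
move=> h; apply/matrixP => i j; rewrite [RHS]mxE; apply/eqP.
have ge0 i' : 0 <= \sum_j `|A i' j| ^+ 2.
  by rewrite sumr_ge0 // => j' _; rewrite exprn_ge0.
have := @psumr_eq0P _ _ predT _ (fun i _ => ge0 i).
rewrite -(eq_bigr _ (fun i _ => tE i)) => /(_ h i isT) hi.
have := @psumr_eq0P _ _ predT _ (fun j _ => exprn_ge0 2 (normr_ge0 (A i j))).
by move=> /(_ hi j isT) /eqP; rewrite expf_eq0 /= normr_eq0.
Qed.

Lemma mulmx_adj_eq0 m n (A : 'M[C]_(m, n)) : A *m adjmx A = 0 -> A = 0.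
Proof. by move=> h; apply: mxtrace_mulmx_adj_eq0; rewrite h mxtrace0. Qed.

Lemma innerZr n c (u v : 'cV[C]_n) : inner u (c *: v) = c * inner u v.
Proof. by rewrite /inner -scalemxAr mxE. Qed.

Lemma innerZl n c (u v : 'cV[C]_n) : inner (c *: u) v = c^* * inner u v.
Proof. by rewrite /inner adjmxZ -scalemxAl mxE. Qed.

Lemma inner_adjmx n (u v : 'cV[C]_n) : adjmx u *m v = (inner u v)%:M.
Proof. exact: mx11_scalar. Qed.

Lemma inner_eq0 n (u v : 'cV[C]_n) : adjmx u *m v = 0 -> inner u v = 0.
Proof. by rewrite /inner => ->; rewrite mxE. Qed.

Lemma inner_conj n (u v : 'cV[C]_n) : (inner u v)^* = inner v u.
Proof.
rewrite /inner; have -> : adjmx v *m u = adjmx (adjmx u *m v).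
  by rewrite adjmxM adjmxK.
by rewrite [in RHS]/adjmx !mxE.
Qed.

Lemma inner_sumE n (u v : 'cV[C]_n) : inner u v = \sum_i (u i 0)^* * v i 0.
Proof. by rewrite /inner mxE; apply: eq_bigr => i _; rewrite !mxE. Qed.

Lemma inner_gt0 n (u : 'cV[C]_n) : u != 0 -> 0 < inner u u.
Proof.
move=> u0; rewrite lt_def; apply/andP; split; last first.
  by rewrite inner_sumE sumr_ge0 // => i _; rewrite mulrC -normCK exprn_ge0.
apply: contra u0 => /eqP h; apply/eqP.
rewrite -[u]adjmxK (@mulmx_adj_eq0 _ _ (adjmx u)) ?adjmx0 //.
by rewrite adjmxK inner_adjmx h raddf0.
Qed.

(** The rows of [spectralmx A] are left eigenvectors; its adjoint [U] has eigenvectors of [A] as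
    columns. *)
Lemma normal_spectral n (A : 'M[C]_n) : A *m adjmx A = adjmx A *m A ->
  exists (U : 'M[C]_n) (d : 'rV[C]_n),
    [/\ adjmx U *m U = 1%:M, U *m adjmx U = 1%:M
      & A = U *m diag_mx d *m adjmx U].
Proof.
rewrite !adjmxE => nA.
have /orthomx_spectralP eA : A \is normalmx by apply/normalmxP.
have uP := spectral_unitarymx A.
have iP := invmx_unitary uP.
exists (adjmx (spectralmx A)), (spectral_diag A).
have PP : spectralmx A *m adjmx (spectralmx A) = 1%:M.
  by rewrite adjmxE; apply/unitarymxP.
split; rewrite adjmxK //; first exact: mulmx1C.
by rewrite adjmxE -iP.
Qed.

End Adjoint.

(** * Algebra of the Kronecker product *)

Section Tensor.
Variable C : numClosedFieldType.

Lemma tensmx_mxtens m n p q (A : 'M[C]_(m, n)) (B : 'M[C]_(p, q)) :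
  tensmx A B = mxtens.tensmx A B.
Proof.
apply/matrixP => i j; rewrite !mxE /=.
by congr (A _ _ * B _ _); apply: val_inj.
Qed.

Lemma tensmxM m n p m' n' p' (A : 'M[C]_(m, n)) (B : 'M[C]_(n, p))
    (A' : 'M[C]_(m', n')) (B' : 'M[C]_(n', p')) :
  tensmx A A' *m tensmx B B' = tensmx (A *m B) (A' *m B').
Proof. by rewrite !tensmx_mxtens mxtens.tensmx_mul. Qed.

Lemma adjmx_tens m n p q (A : 'M[C]_(m, n)) (B : 'M[C]_(p, q)) :
  adjmx (tensmx A B) = tensmx (adjmx A) (adjmx B).
Proof. by apply/matrixP => i j; rewrite !mxE rmorphM. Qed.

Lemma tensmx11 m n : tensmx (1%:M : 'M[C]_m) (1%:M : 'M[C]_n) = 1%:M.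
Proof.
apply/matrixP => i j; rewrite !mxE -natrM mulnb; congr (nat_of_bool _)%:R.
apply/andP/eqP => [[/eqP h1 /eqP h2]|->]; last by [].
apply: val_inj; rewrite /= (divn_eq i n) (divn_eq j n).
by move: (congr1 val h1) (congr1 val h2) => /= -> ->.
Qed.

Lemma tensmxDl m n p q (A A' : 'M[C]_(m, n)) (B : 'M[C]_(p, q)) :
  tensmx (A + A') B = tensmx A B + tensmx A' B.
Proof. by apply/matrixP => i j; rewrite !mxE mulrDl. Qed.

Lemma tensmxDr m n p q (A : 'M[C]_(m, n)) (B B' : 'M[C]_(p, q)) :
  tensmx A (B + B') = tensmx A B + tensmx A B'.
Proof. by apply/matrixP => i j; rewrite !mxE mulrDr. Qed.

Lemma tensmxZl m n p q c (A : 'M[C]_(m, n)) (B : 'M[C]_(p, q)) :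
  tensmx (c *: A) B = c *: tensmx A B.
Proof. by apply/matrixP => i j; rewrite !mxE mulrA. Qed.

Lemma tensmxZr m n p q c (A : 'M[C]_(m, n)) (B : 'M[C]_(p, q)) :
  tensmx A (c *: B) = c *: tensmx A B.
Proof. by apply/matrixP => i j; rewrite !mxE mulrCA. Qed.

Lemma tensmx_suml m n p q (I : finType) (F : I -> 'M[C]_(m, n)) (B : 'M[C]_(p, q)) :
  tensmx (\sum_i F i) B = \sum_i tensmx (F i) B.
Proof.
apply/matrixP => i j; rewrite !(mxE, summxE) mulr_suml.
by apply: eq_bigr => k _; rewrite mxE.
Qed.

Lemma tensmx_sumr m n p q (I : finType) (A : 'M[C]_(m, n)) (F : I -> 'M[C]_(p, q)) :
  tensmx A (\sum_i F i) = \sum_i tensmx A (F i).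
Proof.
apply/matrixP => i j; rewrite !(mxE, summxE) mulr_sumr.
by apply: eq_bigr => k _; rewrite mxE.
Qed.

End Tensor.

(** * Functions and sums over two indices *)

Lemma ord2_ind (P : 'I_2 -> Prop) : P 0 -> P 1 -> forall i, P i.
Proof.
move=> P0 P1 [[|[|//]] hi]; first by rewrite (_ : Ordinal hi = 0) //; apply: val_inj.
by rewrite (_ : Ordinal hi = 1) //; apply: val_inj.
Qed.

Lemma big_ord2 (V : nmodType) (F : 'I_2 -> V) : \sum_i F i = F 0 + F 1.
Proof. by rewrite big_ord_recl big_ord1; congr (_ + F _); apply: val_inj. Qed.

Definition pair_fun T (x y : T) (i : 'I_2) : T := if i == 0 then x else y.

(** * Orthonormal bases, mostly of a single qubit *)

Section OrthonormalBases.
Variable C : numClosedFieldType.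

Definition onb n (a : 'I_n -> 'cV[C]_n) :=
  forall i j, inner (a i) (a j) = (i == j)%:R.

(** With the vectors as columns of [U], orthonormality says that [adjmx U] is a left inverse of the
    square matrix [U], hence also a right inverse. *)
Lemma onb_sum_proj n (a : 'I_n -> 'cV[C]_n) :
  onb a -> \sum_i a i *m adjmx (a i) = 1%:M.
Proof.
move=> ha; pose U := \matrix_(i, j) a j i 0.
have /mulmx1C <- : adjmx U *m U = 1%:M.
  apply/matrixP => i j; rewrite [RHS]mxE -ha inner_sumE mxE.
  by apply: eq_bigr => k _; rewrite !mxE.
apply/matrixP => i j; rewrite summxE mxE; apply: eq_bigr => k _.
by rewrite !mxE big_ord1 !mxE.
Qed.

(** The factors [c] are kept so that relations known for [w] can be carried over to [a]. *)
Lemma onb_normalize (w : 'I_2 -> 'cV[C]_2) :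
  (forall i, w i != 0) -> inner (w 0) (w 1) = 0 ->
  exists (a : 'I_2 -> 'cV[C]_2) (c : 'I_2 -> C),
    [/\ onb a, forall i, c i != 0 & forall i, a i = c i *: w i].
Proof.
move=> w0 w01; have g0 i := inner_gt0 (w0 i).
pose c i := (sqrtC (inner (w i) (w i)))^-1.
exists (fun i => c i *: w i), c; split=> // i; last first.
  by rewrite invr_eq0 sqrtC_eq0 gt_eqF.
have nrm j : inner (c j *: w j) (c j *: w j) = 1.
  rewrite innerZl innerZr /c mulrA geC0_conj; last first.
    by rewrite invr_ge0 sqrtC_ge0 ltW.
  by rewrite -expr2 exprVn sqrtCK mulVf ?gt_eqF.
move: i; apply: ord2_ind; apply: ord2_ind; rewrite ?nrm ?eqxx //.
  by rewrite innerZl innerZr w01 !mulr0.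
by rewrite innerZl innerZr -inner_conj w01 conjC0 !mulr0.
Qed.

Definition perp (w : 'cV[C]_2) : 'cV[C]_2 :=
  \col_i pair_fun (- (w 1 0)^*) ((w 0 0)^*) i.

Lemma inner_perp w : inner w (perp w) = 0.
Proof. by rewrite inner_sumE big_ord2 !mxE /pair_fun /=; ring. Qed.

Lemma perp_neq0 w : w != 0 -> perp w != 0.
Proof.
apply: contra => /eqP/matrixP h; apply/eqP/matrixP => i j.
rewrite [j]ord1 [RHS]mxE; move: (h 0 0) (h 1 0); rewrite !mxE /pair_fun /=.
move=> /eqP; rewrite oppr_eq0 fmorph_eq0 => /eqP h1.
move=> /eqP; rewrite fmorph_eq0 => /eqP h0.
by move: i; apply: ord2_ind.
Qed.

Lemma onb_extend (w : 'cV[C]_2) : w != 0 ->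
  exists (a : 'I_2 -> 'cV[C]_2) (c : C), [/\ onb a, c != 0 & a 0 = c *: w].
Proof.
move=> w0; have [|a [c [ha hc hac]]] :=
  @onb_normalize (pair_fun w (perp w)) _ (inner_perp w).
  by apply: ord2_ind => //; apply: perp_neq0.
by exists a, (c 0); split=> //; apply: hac.
Qed.

Lemma exists_onb : exists a : 'I_2 -> 'cV[C]_2, onb a.
Proof.
have [|a [c [ha _ _]]] := @onb_extend (const_mx 1); last by exists a.
by apply/eqP => /matrixP/(_ 0 0)/eqP; rewrite !mxE oner_eq0.
Qed.

(* A point of the form (1, t u) where u makes the imaginary part vanish for
   every real t and t solves the remaining real quadratic equation. *)
Lemma traceless_isotropic (M : 'M[C]_2) : \tr M = 0 ->
  exists2 v : 'cV[C]_2, v != 0 & adjmx v *m M *m v = 0.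
Proof.
have quadE v : (adjmx v *m M *m v) 0 0 =
    (v 0 0)^* * M 0 0 * v 0 0 + (v 0 0)^* * M 0 1 * v 1 0
  + (v 1 0)^* * M 1 0 * v 0 0 + (v 1 0)^* * M 1 1 * v 1 0.
  by rewrite !mxE big_ord2 !mxE !big_ord2 !mxE; ring.
have vE (v : 'cV[C]_2) : v 0 0 = 1 -> v != 0.
  by move=> h; apply/eqP => v0; move: h; rewrite v0 mxE => /eqP; rewrite eq_sym oner_eq0.
rewrite /mxtrace big_ord2 addrC => /eqP; rewrite addr_eq0 => /eqP trM.
suff [z hz] : exists z, M 0 0 + M 0 1 * z + z^* * M 1 0 - z^* * M 0 0 * z = 0.
  exists (\col_i pair_fun 1 z i); first by apply: vE; rewrite mxE.
  rewrite [LHS]mx11_scalar quadE !mxE /pair_fun /= trM conjC1.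
  by rewrite -[X in X%:M = _](_ : 0 = _) ?raddf0 // -[LHS]hz; ring.
have [M0|M0] := eqVneq (M 0 0) 0.
  by exists 0; rewrite M0 conjC0; ring.
set m := M 0 0 in M0 *; pose p := M 0 1 / m; pose q := M 1 0 / m.
suff [z hz] : exists z, 1 + p * z + q * z^* - z * z^* = 0.
  exists z; transitivity (m * (1 + p * z + q * z^* - z * z^*)); last by rewrite hz mulr0.
  by rewrite /p /q; field.
(* For [z = t * u] with [t] real the equation becomes [1 + t * b - t ^+ 2 * g = 0]. The imaginary
   part of [b] is that of [d * u], which vanishes for [u = d^*]; if [d = 0], any nonzero [u] will
   do. *)
clearbody p q; pose d := p - q^*; pose u := if d == 0 then 1 else d^*.
have u0 : u != 0 by rewrite /u; case: ifP => [_|/negbT]; rewrite ?oner_eq0 ?fmorph_eq0.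
have du : (d * u)^* = d * u.
  rewrite /u; case: ifPn => [/eqP ->|_]; first by rewrite mul0r conjC0.
  by rewrite rmorphM /= conjCK mulrC.
clearbody u; pose b := p * u + q * u^*; pose g := u * u^*.
have g0 : 0 < g by rewrite /g -normCK exprn_gt0 // normr_gt0.
have bR : b \is Num.real.
  apply/CrealP; rewrite /b rmorphD /= !rmorphM /= conjCK.
  move: du; rewrite /d rmorphM /= rmorphB /= conjCK => du.
  apply/eqP; rewrite -subr_eq0; apply/eqP.
  transitivity ((p^* - q) * u^* - (p - q^*) * u); last by rewrite du subrr.
  by ring.
(* A root of this quadratic; it is real since [b] is real and [g] positive. *)
pose t := (b + sqrtC (b ^+ 2 + 4 * g)) / (2 * g).
have D0 : 0 <= b ^+ 2 + 4 * g.
  by rewrite addr_ge0 ?real_exprn_even_ge0 // mulr_ge0 // ltW.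
have tR : t^* = t.
  have rR : sqrtC (b ^+ 2 + 4 * g) \is Num.real by rewrite ger0_real ?sqrtC_ge0.
  have gR : 2 * g \is Num.real by rewrite ger0_real // mulr_ge0 // ltW.
  by apply/CrealP/rpredM; [apply: rpredD | rewrite rpredV].
exists (t * u); rewrite rmorphM /= tR.
transitivity (1 + t * b - t ^+ 2 * g); first by rewrite /b /g; ring.
have sD := sqrtCK (b ^+ 2 + 4 * g).
rewrite /t; set r := sqrtC _ in sD *.
have gn : g != 0 by rewrite gt_eqF.
transitivity ((b ^+ 2 + 4 * g - r ^+ 2) / (4 * g)); first by field.
by rewrite sD subrr mul0r.
Qed.

(** A normalised isotropic vector serves as [a 0]; the two diagonal entries add up to the trace, so
    the other one vanishes too. *)
Lemma traceless_onb (M : 'M[C]_2) : \tr M = 0 ->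
  exists2 a : 'I_2 -> 'cV[C]_2, onb a & forall i, adjmx (a i) *m M *m a i = 0.
Proof.
move=> trM; have [v v0 hv] := traceless_isotropic trM.
have [a [c [ha c0 a0]]] := onb_extend v0.
have h0 : adjmx (a 0) *m M *m a 0 = 0.
  by rewrite a0 adjmxZ -!scalemxAl -scalemxAr hv !scaler0.
exists a => //; apply: ord2_ind => //.
rewrite [LHS]mx11_scalar -trace_mx11 mxtrace_mulC mulmxA.
have /eqP := onb_sum_proj ha; rewrite big_ord2 eq_sym addrC -subr_eq => /eqP <-.
rewrite mulmxBl mul1mx raddfB /= trM -mulmxA mxtrace_mulC h0.
by rewrite mxtrace0 subrr raddf0.
Qed.

(* At most two of the [Y k] are nonzero, and if two are, both have rank one. *)
Lemma orth_family_onb N n (Y : 'I_N -> 'M[C]_(2, n)) :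
  (forall k l, k != l -> adjmx (Y k) *m Y l = 0) ->
  exists (b : 'I_2 -> 'cV[C]_2) (f : 'I_2 -> nat), onb b /\
    forall j (k : 'I_N), f j != k -> adjmx (b j) *m Y k = 0.
Proof.
move=> hY; have [/existsP[k Yk]|] := boolP [exists k, Y k != 0]; last first.
  rewrite negb_exists => /forallP Y0; have [b hb] := exists_onb.
  exists b, (fun=> 0%N); split=> // j k _.
  by move: (Y0 k); rewrite negbK => /eqP ->; rewrite mulmx0.
have colP (A : 'M[C]_(2, n)) : A != 0 -> exists x : 'cV[C]_n, A *m x != 0.
  case/matrix0Pn => i [j Aij]; exists (delta_mx j 0); rewrite -colE.
  by apply/cV0Pn; exists i; rewrite mxE.
have [x wk] := colP _ Yk; have [b [c [hb c0 b0]]] := onb_extend wk.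
have h0 l : k != l -> adjmx (b 0) *m Y l = 0.
  by move=> kl; rewrite b0 adjmxZ adjmxM -scalemxAl -mulmxA hY // mulmx0 scaler0.
have [/existsP[l /andP[lk Yl]]|] := boolP [exists l, (l != k) && (Y l != 0)]; last first.
  rewrite negb_exists => /forallP Y0; exists b, (fun=> nat_of_ord k); split=> // j l.
  rewrite -[_ != _]/(k != l) => kl.
  move: (Y0 l); rewrite eq_sym negb_and negbK (negbTE kl) /= negbK => /eqP ->.
  by rewrite mulmx0.
have [y wl] := colP _ Yl.
(* The columns of [Y l] are orthogonal to [b 0], hence multiples of [b 1]. So [b 1] lies in the
   column space of [Y l], to which all other [Y j] are orthogonal. *)
have eYl : Y l *m y = inner (b 1) (Y l *m y) *: b 1.
  rewrite -[LHS]mul1mx -(onb_sum_proj hb) big_ord2 mulmxDl -!mulmxA.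
  rewrite [X in _ *m X + _]mulmxA h0 1?eq_sym // mul0mx mulmx0 add0r.
  by rewrite inner_adjmx mul_mx_scalar.
have h1 j : l != j -> adjmx (b 1) *m Y j = 0.
  move=> lj; have i0 : inner (b 1) (Y l *m y) != 0.
    by apply: contra wl => /eqP e; rewrite eYl e scale0r.
  have -> : b 1 = (inner (b 1) (Y l *m y))^-1 *: (Y l *m y).
    by rewrite [in RHS]eYl innerZr hb mulr1 scalerA mulVf ?scale1r.
  by rewrite adjmxZ adjmxM -scalemxAl -mulmxA hY // mulmx0 scaler0.
exists b, (pair_fun (nat_of_ord k) (nat_of_ord l)); split=> //.
by apply: ord2_ind => j /= hj; [apply: h0 | apply: h1].
Qed.

End OrthonormalBases.

(** * Product vectors and local labellings *)

Section ProductVectors.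
Variable C : numClosedFieldType.

(* The boolean [s] selects the party playing the leading role: Alice if true,
   Bob if false. *)
Definition prodv (s : bool) (a b : 'cV[C]_2) : 'cV[C]_(2 * 2) :=
  if s then tensmx a b else tensmx b a.

Definition localmx (s : bool) (E : 'M[C]_2) : 'M[C]_(2 * 2) :=
  if s then tensmx E 1%:M else tensmx 1%:M E.

Lemma prodvC s a b : prodv (~~ s) a b = prodv s b a.
Proof. by case: s. Qed.

Lemma prodv_mul_adj s a b a' b' : prodv s a b *m adjmx (prodv s a' b') =
  (if s then tensmx (a *m adjmx a') (b *m adjmx b')
   else tensmx (b *m adjmx b') (a *m adjmx a')).
Proof.
rewrite /prodv; case: s.
  by rewrite (adjmx_tens a' b') (tensmxM a (adjmx a') b (adjmx b')).
by rewrite (adjmx_tens b' a') (tensmxM b (adjmx b') a (adjmx a')).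
Qed.

Lemma inner_prodv s a b a' b' :
  inner (prodv s a b) (prodv s a' b') = inner a a' * inner b b'.
Proof.
have tensP (u v u' v' : 'cV[C]_2) :
    inner (prodv true u v) (prodv true u' v') = inner u u' * inner v v'.
  rewrite /inner (adjmx_tens u v) (tensmxM (adjmx u) u' (adjmx v) v') mxE.
  by rewrite [tens_idx1 _]ord1 [tens_idx2 _]ord1.
by case: s; [exact: tensP | rewrite mulrC; exact: tensP].
Qed.

Lemma prodvZl s c a b : prodv s (c *: a) b = c *: prodv s a b.
Proof. by rewrite /prodv; case: s; rewrite ?tensmxZl ?tensmxZr. Qed.

Lemma prodvZr s c a b : prodv s a (c *: b) = c *: prodv s a b.
Proof. by rewrite -!(prodvC s) prodvZl. Qed.

Lemma prodv0l s b : prodv s 0 b = 0.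
Proof. by rewrite -[0](scale0r 0) prodvZl !scale0r. Qed.

Lemma prodv_neq0 s a b : prodv s a b != 0 -> a != 0 /\ b != 0.
Proof.
move=> h; split; apply: contra h => /eqP ->; first by rewrite prodv0l.
by rewrite -(prodvC s) prodv0l.
Qed.

Lemma prodv_suml s (I : finType) (F : I -> 'cV[C]_2) b :
  prodv s (\sum_i F i) b = \sum_i prodv s (F i) b.
Proof. by rewrite /prodv; case: s; rewrite ?tensmx_suml ?tensmx_sumr. Qed.

Lemma localmx_is_linear s : linear (localmx s).
Proof.
move=> c E F; rewrite /localmx; case: s; first by rewrite tensmxDl tensmxZl.
by rewrite tensmxDr tensmxZr.
Qed.
HB.instance Definition _ s :=
  GRing.isLinear.Build C 'M[C]_2 'M[C]_(2 * 2) _ (localmx s) (localmx_is_linear s).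

Lemma localmx1 s : localmx s 1%:M = 1%:M.
Proof. by rewrite /localmx; case: s; rewrite tensmx11. Qed.

Lemma localmx_proj s a (b : 'I_2 -> 'cV[C]_2) : onb b ->
  localmx s (a *m adjmx a) = \sum_j prodv s a (b j) *m adjmx (prodv s a (b j)).
Proof.
move=> hb; rewrite /localmx -(onb_sum_proj hb).
case: s; rewrite ?tensmx_sumr ?tensmx_suml; apply: eq_bigr => j _;
  by rewrite prodv_mul_adj.
Qed.

Lemma prodv_basis s (a : 'I_2 -> 'cV[C]_2) (b : 'I_2 -> 'I_2 -> 'cV[C]_2) :
  onb a -> (forall i, onb (b i)) ->
  \sum_i \sum_j prodv s (a i) (b i j) *m adjmx (prodv s (a i) (b i j)) = 1%:M.
Proof.
move=> ha hb; rewrite -(localmx1 s) -(onb_sum_proj ha) linear_sum /=.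
by apply: eq_bigr => i _; rewrite (localmx_proj s (a i) (hb i)).
Qed.

(** A one-way measurement whose second basis adapts to the first outcome. Each [X k] matters only
    through its column space. Labels are natural numbers rather than elements of ['I_N], so that the
    case [N = 0] is covered. *)
Definition local_labelling N n (X : 'I_N -> 'M[C]_(2 * 2, n)) : Prop :=
  exists (s : bool) (a : 'I_2 -> 'cV[C]_2) (b : 'I_2 -> 'I_2 -> 'cV[C]_2)
         (f : 'I_2 -> 'I_2 -> nat),
    [/\ onb a, forall i, onb (b i)
      & forall i j (k : 'I_N), f i j != k -> adjmx (prodv s (a i) (b i j)) *m X k = 0].

(** Outcome [a i] leaves the other qubit with the unnormalised [Y i k]. For fixed [i] the hypothesis
    makes these orthogonal for distinct [k], so [orth_family_onb] gives the second basis and its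
    labels. *)
Lemma local_labelling_of_onb N n (X : 'I_N -> 'M[C]_(2 * 2, n)) s
    (a : 'I_2 -> 'cV[C]_2) :
  onb a ->
  (forall i k l, k != l -> adjmx (X k) *m localmx s (a i *m adjmx (a i)) *m X l = 0) ->
  local_labelling X.
Proof.
move=> ha hX; pose e (j : 'I_2) : 'cV[C]_2 := delta_mx j 0.
have he : onb e.
  move=> i j; rewrite inner_sumE (bigD1 i) //= big1 ?addr0 => [|k /negbTE ki].
    by rewrite !mxE !eqxx conjC1 mul1r andbT.
  by rewrite !mxE ki /= conjC0 mul0r.
pose Y i k : 'M[C]_(2, n) := \matrix_(j, c) (adjmx (prodv s (a i) (e j)) *m X k) 0 c.
(* [Y i k] is defined by its coordinates in the standard basis; conjugate linearity extends the
   formula to every [b]. *)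
have Y_row i (b : 'cV[C]_2) k : adjmx b *m Y i k = adjmx (prodv s (a i) b) *m X k.
  have -> : prodv s (a i) b = \sum_j b j 0 *: prodv s (a i) (e j).
    rewrite -prodvC {1}(_ : b = \sum_j b j 0 *: e j) ?prodv_suml.
      by apply: eq_bigr => j _; rewrite prodvZl prodvC.
    by rewrite [LHS]matrix_sum_delta; apply: eq_bigr => j _; rewrite big_ord1.
  apply/matrixP => r c; rewrite [r]ord1 !mxE.
  under [in RHS]eq_bigr => j _.
    rewrite /adjmx !mxE summxE rmorph_sum mulr_suml; over.
  rewrite exchange_big; apply: eq_bigr => j _; rewrite !mxE mulr_sumr.
  by apply: eq_bigr => q _; rewrite !mxE rmorphM mulrA.
have Y_orth i k l : k != l -> adjmx (Y i k) *m Y i l = 0.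
  move=> kl; rewrite -[RHS](hX i k l kl) (localmx_proj s (a i) he) mulmx_sumr mulmx_suml.
  rewrite -[X in X *m _]mulmx1 -(onb_sum_proj he) mulmx_sumr mulmx_suml.
  apply: eq_bigr => j _; rewrite -!mulmxA Y_row.
  rewrite mulmxA -[adjmx (Y i k) *m e j]adjmxK adjmxM adjmxK Y_row.
  by rewrite adjmxM adjmxK -!mulmxA.
have [B [f hBf]] : exists (b : 'I_2 -> 'I_2 -> 'cV[C]_2) (f : 'I_2 -> 'I_2 -> nat),
    forall i, onb (b i) /\ forall j (k : 'I_N), f i j != k -> adjmx (b i j) *m Y i k = 0.
  have [b0 [f0 h0]] := orth_family_onb (Y_orth 0).
  have [b1 [f1 h1]] := orth_family_onb (Y_orth 1).
  by exists (pair_fun b0 b1), (pair_fun f0 f1); apply: ord2_ind.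
exists s, a, B, f; split=> // [i|i j k fk]; first by case: (hBf i).
by rewrite -Y_row; case: (hBf i) => _; apply.
Qed.

End ProductVectors.

(** * Protocols and local labellings *)

Section Protocols.
Variables (C : numClosedFieldType) (N : nat).

(** The Kraus operators are the row vectors [adjmx (a i)], then [adjmx (b i j)], so each measurement
    reduces a qubit to dimension 1. A wrongly labelled leaf has zero amplitude on [X k]. *)
Lemma local_labelling_LOCC n (X : 'I_N -> 'M[C]_(2 * 2, n)) :
  local_labelling X -> LOCC_perfectly_distinguishable (fun k => X k *m adjmx (X k)).
Proof.
case=> s [a [b [f [ha hb hX]]]].
have vP (c : 'I_2 -> 'cV[C]_2) : onb c ->
    \sum_i adjmx (adjmx (c i)) *m adjmx (c i) = 1%:M.
  by move=> hc; under eq_bigr do rewrite adjmxK; apply: onb_sum_proj.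
have trP m p (T1 : 'M[C]_(m, 2 * 2)) (T2 : 'M[C]_(p, m)) k :
    T2 *m T1 *m X k = 0 ->
    \tr (T2 *m (T1 *m (X k *m adjmx (X k)) *m adjmx T1) *m adjmx T2) = 0.
  by move=> h; rewrite !mulmxA h !mul0mx mxtrace0.
case: s hX => hX.
- exists (@AStep C N 2 2 2 1 (fun i => adjmx (a i)) (fun i =>
    @BStep C N 1 2 2 1 (fun j => adjmx (b i j)) (fun j => Leaf C N 1 1 (f i j)))).
  split=> [|k i j] /=.
    by split=> [|i]; [exact: vP | split=> [|//]; exact: vP].
  have [->|fk] := eqVneq (f i j) k; [by right | left].
  apply: trP; rewrite tensmxM mul1mx mulmx1; have := hX i j k fk.
  by rewrite /prodv (adjmx_tens (a i) (b i j)).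
- exists (@BStep C N 2 2 2 1 (fun i => adjmx (a i)) (fun i =>
    @AStep C N 2 1 2 1 (fun j => adjmx (b i j)) (fun j => Leaf C N 1 1 (f i j)))).
  split=> [|k i j] /=.
    by split=> [|i]; [exact: vP | split=> [|//]; exact: vP].
  have [->|fk] := eqVneq (f i j) k; [by right | left].
  apply: trP; rewrite tensmxM mul1mx mulmx1; have := hX i j k fk.
  by rewrite /prodv (adjmx_tens (b i j) (a i)).
Qed.

(* The branches of a valid protocol resolve the identity. *)
Lemma identifies_orth da db (p : protocol C N da db) : valid_protocol p ->
  forall n1 n2 (X : 'M[C]_(da * db, n1)) (Y : 'M[C]_(da * db, n2)) (k l : 'I_N),
  k != l -> identifies p (X *m adjmx X) k -> identifies p (Y *m adjmx Y) l ->
  adjmx X *m Y = 0.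
Proof.
elim: p => {da db} [da db r|da db m dout K next IH|da db m dout K next IH] /=.
- move=> _ n1 n2 X Y k l kl.
  (* A leaf carries one label, so one of the two states reaches it with probability zero and its
     factor vanishes. *)
  case=> [/mxtrace_mulmx_adj_eq0 -> _|->]; first by rewrite adjmx0 mul0mx.
  case=> [/mxtrace_mulmx_adj_eq0 ->|/val_inj e]; first by rewrite mulmx0.
  by rewrite e eqxx in kl.
- case=> sumK valid n1 n2 X Y k l kl hX hY.
  rewrite -[Y]mul1mx -tensmx11 -sumK tensmx_suml mulmx_suml mulmx_sumr.
  apply: big1 => i _; have := IH i (valid i) n1 n2
    (tensmx (K i) 1%:M *m X) (tensmx (K i) 1%:M *m Y) k l kl.
  rewrite ![adjmx (_ *m _)]adjmxM !mulmxA.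
  move: (hX i) (hY i); rewrite !mulmxA => hXi hYi /(_ hXi hYi) <-.
  rewrite adjmx_tens adjmx1 -![X in _ = X]mulmxA -!mulmxA.
  by rewrite (mulmxA (tensmx _ _)) tensmxM mul1mx.
- case=> sumK valid n1 n2 X Y k l kl hX hY.
  rewrite -[Y]mul1mx -tensmx11 -sumK tensmx_sumr mulmx_suml mulmx_sumr.
  apply: big1 => i _; have := IH i (valid i) n1 n2
    (tensmx 1%:M (K i) *m X) (tensmx 1%:M (K i) *m Y) k l kl.
  rewrite ![adjmx (_ *m _)]adjmxM !mulmxA.
  move: (hX i) (hY i); rewrite !mulmxA => hXi hYi /(_ hXi hYi) <-.
  rewrite adjmx_tens adjmx1 -![X in _ = X]mulmxA -!mulmxA.
  by rewrite (mulmxA (tensmx _ _)) tensmxM mul1mx.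
Qed.

Lemma adjmx_gram m n (A : 'M[C]_(m, n)) : adjmx (adjmx A *m A) = adjmx A *m A.
Proof. by rewrite adjmxM adjmxK. Qed.

(* As long as all effects are scalar the parties have only applied local
   isometries up to scaling (A and B below); the first nonscalar effect E must
   preserve orthogonality. *)
Lemma protocol_nonscalar_effect da db (p : protocol C N da db)
    (X : 'I_N -> 'M[C]_(2 * 2)) :
  (forall k, X k != 0) -> valid_protocol p ->
  forall (A : 'M[C]_(da, 2)) (B : 'M[C]_(db, 2)) (al be : C),
  al != 0 -> be != 0 -> adjmx A *m A = al%:M -> adjmx B *m B = be%:M ->
  (forall k, identifies p (tensmx A B *m X k *m adjmx (tensmx A B *m X k)) k) ->
  (N <= 1)%N \/ exists (s : bool) (E : 'M[C]_2),
    [/\ adjmx E = E, ~~ is_scalar_mx E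
      & forall k l, k != l -> adjmx (X k) *m localmx s E *m X l = 0].
Proof.
move=> X0.
elim: p => {da db} [da db r|da db m dout K next IH|da db m dout K next IH] /=.
- move=> _ A B al be al0 be0 hA hB hid; left.
  (* [A] and [B] are injective, so no state vanishes at the leaf and its label must be right for
     every [k]. *)
  have lab (k : 'I_N) : r = k.
    case: (hid k) => [/mxtrace_mulmx_adj_eq0 h|//].
    have : al *: (be *: X k) = 0.
      have := congr1 (mulmx (adjmx (tensmx A B))) h.
      rewrite mulmx0 mulmxA adjmx_tens tensmxM hA hB -[al%:M]scalemx1 -[be%:M]scalemx1.
      by rewrite tensmxZl tensmxZr tensmx11 -!scalemxAl mul1mx.
    move/eqP; rewrite !scaler_eq0 (negbTE al0) (negbTE be0) /=.
    by rewrite (negbTE (X0 k)).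
  rewrite leqNgt; apply/negP => N1.
  by have := lab (Ordinal N1); rewrite (lab (Ordinal (ltnW N1))).
- case=> sumK valid A B al be al0 be0 hA hB hid.
  pose E i := adjmx (K i *m A) *m (K i *m A).
  have hidi i k : identifies (next i)
      (tensmx (K i *m A) B *m X k *m adjmx (tensmx (K i *m A) B *m X k)) k.
    have := hid k i; congr identifies.
    by rewrite -[B in RHS]mul1mx -tensmxM !adjmxM !mulmxA.
  have [/existsP[i nE]|] := boolP [exists i, ~~ is_scalar_mx (E i)].
    right; exists true, (E i); split=> // [|k l kl]; first exact: adjmx_gram.
    (* The rest of the protocol still separates the states of branch [i], so they are orthogonal. As
       [adjmx B *m B] is the nonzero scalar [be], only [E i] remains between [X k] and [X l]. *)
    have := identifies_orth (valid i) kl (hidi i k) (hidi i l).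
    rewrite adjmxM adjmx_tens -!mulmxA (mulmxA (tensmx _ _)) tensmxM hB.
    rewrite -[be%:M]scalemx1 tensmxZr -scalemxAl -scalemxAr mulmxA => /eqP.
    by rewrite scaler_eq0 (negbTE be0) /= /E !mulmxA => /eqP.
  rewrite negb_exists => /forallP scE.
  have sumE : \sum_i E i = al%:M.
    rewrite -hA -[X in _ = _ *m X]mul1mx -sumK mulmx_suml mulmx_sumr.
    by apply: eq_bigr => i _; rewrite /E adjmxM !mulmxA.
  (* The effects add up to [al != 0], so some branch has a nonzero scalar effect; following it keeps
     the invariant, with [K i *m A] in place of [A]. *)
  have [/existsP[i nE]|] := boolP [exists i, E i != 0]; last first.
    rewrite negb_exists => /forallP E0; move: sumE.
    rewrite big1 => [|i _]; last by apply/eqP; move: (E0 i); rewrite negbK.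
    by move/matrixP/(_ 0 0); rewrite !mxE => /esym/eqP; rewrite (negbTE al0).
  move: (scE i); rewrite negbK => /is_scalar_mxP[e eE].
  apply: (IH i (valid i) (K i *m A) B e be) => //.
  by apply: contra nE; rewrite eE => /eqP ->; rewrite raddf0.
- case=> sumK valid A B al be al0 be0 hA hB hid.
  pose E i := adjmx (K i *m B) *m (K i *m B).
  have hidi i k : identifies (next i)
      (tensmx A (K i *m B) *m X k *m adjmx (tensmx A (K i *m B) *m X k)) k.
    have := hid k i; congr identifies.
    by rewrite -[A in RHS]mul1mx -tensmxM !adjmxM !mulmxA.
  have [/existsP[i nE]|] := boolP [exists i, ~~ is_scalar_mx (E i)].
    right; exists false, (E i); split=> // [|k l kl]; first exact: adjmx_gram.
    have := identifies_orth (valid i) kl (hidi i k) (hidi i l).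
    rewrite adjmxM adjmx_tens -!mulmxA (mulmxA (tensmx _ _)) tensmxM hA.
    rewrite -[al%:M]scalemx1 tensmxZl -scalemxAl -scalemxAr mulmxA => /eqP.
    by rewrite scaler_eq0 (negbTE al0) /= /E !mulmxA => /eqP.
  rewrite negb_exists => /forallP scE.
  have sumE : \sum_i E i = be%:M.
    rewrite -hB -[X in _ = _ *m X]mul1mx -sumK mulmx_suml mulmx_sumr.
    by apply: eq_bigr => i _; rewrite /E adjmxM !mulmxA.
  have [/existsP[i nE]|] := boolP [exists i, E i != 0]; last first.
    rewrite negb_exists => /forallP E0; move: sumE.
    rewrite big1 => [|i _]; last by apply/eqP; move: (E0 i); rewrite negbK.
    by move/matrixP/(_ 0 0); rewrite !mxE => /esym/eqP; rewrite (negbTE be0).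
  move: (scE i); rewrite negbK => /is_scalar_mxP[e eE].
  apply: (IH i (valid i) A (K i *m B) al e) => //.
  by apply: contra nE; rewrite eE => /eqP ->; rewrite raddf0.
Qed.

(** The only possible index is 0, so the constant label 0 is never wrong. *)
Lemma local_labelling_le1 n (X : 'I_N -> 'M[C]_(2 * 2, n)) :
  (N <= 1)%N -> local_labelling X.
Proof.
move=> N1; have [a ha] := exists_onb C.
exists true, a, (fun=> a), (fun _ _ => 0%N); split=> // i j k.
by have := leq_trans (ltn_ord k) N1; rewrite ltnS leqn0 => /eqP ->.
Qed.

(* A nonscalar Hermitian E and the identity span both spectral projections of E. *)
Lemma LOCC_local_labelling (X : 'I_N -> 'M[C]_(2 * 2)) :
  (forall k, X k != 0) -> (forall k l, k != l -> adjmx (X k) *m X l = 0) ->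
  LOCC_perfectly_distinguishable (fun k => X k *m adjmx (X k)) -> local_labelling X.
Proof.
move=> X0 hX [p [valid hid]].
case: (@protocol_nonscalar_effect 2 2 p X X0 valid 1%:M 1%:M 1 1).
- exact: oner_neq0.
- exact: oner_neq0.
- by rewrite adjmx1 mul1mx.
- by rewrite adjmx1 mul1mx.
- by move=> k; rewrite tensmx11 mul1mx.
- exact: local_labelling_le1.
case=> s [E [hE nE orthE]].
have [|U [d [UU _ eE]]] := @normal_spectral _ _ E; first by rewrite hE.
pose a i := col i U.
have ha : onb a.
  move=> i j; transitivity ((adjmx U *m U) i j); last by rewrite UU mxE.
  by rewrite inner_sumE mxE; apply: eq_bigr => r _; rewrite !mxE.
have eE2 : E = \sum_i d 0 i *: (a i *m adjmx (a i)).
  rewrite eE; apply/matrixP => i j; rewrite summxE mxE.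
  by apply: eq_bigr => r _; rewrite mul_mx_diag !mxE big_ord1 !mxE; ring.
have d01 : d 0 0 != d 0 1.
  apply: contra nE => /eqP dd; apply/is_scalar_mxP; exists (d 0 0).
  by rewrite eE2 -scalemx1 -(onb_sum_proj ha) !big_ord2 scalerDr dd.
apply: (@local_labelling_of_onb _ _ _ X s a ha) => i k l kl.
(* Lagrange interpolation at the two distinct eigenvalues of [E]. *)
have [c [e ->]] : exists c e, a i *m adjmx (a i) = c *: 1%:M + e *: E.
  have d10 := d01; rewrite -subr_eq0 in d01; rewrite eq_sym -subr_eq0 in d10.
  rewrite -(onb_sum_proj ha) eE2 !big_ord2.
  move: i; apply: ord2_ind; move: (a 0 *m _) (a 1 *m _) => P0 P1.
    exists (- d 0 1 / (d 0 0 - d 0 1)), (d 0 0 - d 0 1)^-1.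
    by apply/matrixP => i j; rewrite !mxE; field.
  exists (- d 0 0 / (d 0 1 - d 0 0)), (d 0 1 - d 0 0)^-1.
  by apply/matrixP => i j; rewrite !mxE; field.
rewrite linearD !linearZ /= localmx1 mulmxDr mulmxDl -!scalemxAr -!scalemxAl.
by rewrite orthE // mulmx1 hX // !scaler0 addr0.
Qed.

End Protocols.

(** * Supports and the orthogonal Schmidt number *)

Section Support.
Variable C : numClosedFieldType.

Lemma col_mulmx_diag m n (A : 'M[C]_(m, n)) (d : 'rV[C]_n) i :
  col i (A *m diag_mx d) = d 0 i *: col i A.
Proof. by apply/matrixP => x y; rewrite mul_mx_diag !mxE mulrC. Qed.

(** Scale the columns of the unitary [U] by the square roots of the eigenvalues: this kills those of
    eigenvalue zero, and the others span the support. *)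
Lemma psd_factor n (rho : 'M[C]_n) : adjmx rho = rho -> psd rho ->
  exists2 X : 'M[C]_n, rho = X *m adjmx X
    & forall v, in_supp rho v <-> exists u, v = X *m u.
Proof.
move=> hrho prho; have [|U [d [UU _ eR]]] := @normal_spectral _ _ rho; first by rewrite hrho.
have rU : rho *m U = U *m diag_mx d by rewrite eR -mulmxA UU mulmx1.
have rcol (A : 'M[C]_n) i : rho *m col i A = col i (rho *m A).
  by rewrite !colE mulmxA.
have d0 i : 0 <= d 0 i.
  have <- : inner (col i U) (rho *m col i U) = d 0 i; last exact: prho.
  rewrite rcol rU col_mulmx_diag innerZr.
  suff -> : inner (col i U) (col i U) = 1 by rewrite mulr1.
  transitivity ((adjmx U *m U) i i); last by rewrite UU mxE eqxx.
  by rewrite inner_sumE mxE; apply: eq_bigr => j _; rewrite !mxE.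
pose D := diag_mx (map_mx sqrtC d).
have DD : D *m D = diag_mx d.
  rewrite mul_diag_mx; apply/matrixP => i j; rewrite !mxE.
  by case: eqP => [->|_]; rewrite ?mulr0 // mulr1n -expr2 sqrtCK.
have adjD : adjmx D = D.
  apply/matrixP => i j; rewrite !mxE eq_sym.
  case: eqP => [->|_]; rewrite ?conjC0 // !mulr1n.
  by rewrite geC0_conj // sqrtC_ge0.
pose X := U *m D.
have rX : rho = X *m adjmx X by rewrite adjmxM adjD mulmxA -(mulmxA U) DD -eR.
exists X => // v; split=> [[m [lam [w [hw ->]]]]|[u ->]].
  (* Each [w i] is [rho] applied to [(lam i)^-1 *: w i], so it lies in the range of [X]. *)
  exists (adjmx X *m \sum_i (lam i)^-1 *: w i); rewrite mulmxA -rX mulmx_sumr.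
  apply: eq_bigr => i _; have [l0 rw] := hw i.
  by rewrite -scalemxAr rw scalerA mulVf ?scale1r ?gt_eqF.
(* Columns of eigenvalue zero vanish in [X]; they are given the eigenvalue 1 because [in_supp] asks
   for positive ones and accepts zero vectors. *)
exists n, (fun i => if d 0 i == 0 then 1 else d 0 i), (fun i => u i 0 *: col i X).
split=> [i|]; last first.
  rewrite {1}[u]matrix_sum_delta mulmx_sumr; apply: eq_bigr => i _.
  by rewrite big_ord1 -scalemxAr colE.
have rXi : rho *m col i X = d 0 i *: col i X.
  by rewrite rcol mulmxA rU -mulmxA diag_mxC mulmxA col_mulmx_diag.
case: eqP => [di0|/eqP di0]; split; rewrite ?ltr01 //.
- rewrite scale1r col_mulmx_diag [map_mx _ _ _ _]mxE di0 sqrtC0 scale0r.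
  by rewrite scaler0 mulmx0.
- by rewrite lt_def di0 d0.
- by rewrite -scalemxAr rXi !scalerA mulrC.
Qed.

(** When a vector of the support is expanded in the product basis, only the terms labelled [k]
    survive. *)
Lemma local_labelling_cover N n (X : 'I_N -> 'M[C]_(2 * 2, n)) s
    (a : 'I_2 -> 'cV[C]_2) (b : 'I_2 -> 'I_2 -> 'cV[C]_2) (f : 'I_2 -> 'I_2 -> nat)
    (k : 'I_N) (rho : 'M[C]_(2 * 2)) :
  onb a -> (forall i, onb (b i)) ->
  (forall i j, f i j != k -> adjmx (prodv s (a i) (b i j)) *m X k = 0) ->
  (forall v, in_supp rho v -> exists u, v = X k *m u) ->
  orth_prod_cover rho #|[set x : 'I_2 * 'I_2 | f x.1 x.2 == k]|.
Proof.
move=> ha hb hX hsupp; set F := [set x | _].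
pose e (x : 'I_2 * 'I_2) := prodv s (a x.1) (b x.1 x.2).
pose A (x : 'I_2 * 'I_2) := if s then a x.1 else b x.1 x.2.
pose B (x : 'I_2 * 'I_2) := if s then b x.1 x.2 else a x.1.
have eE x : tensmx (A x) (B x) = e x by rewrite /e /prodv /A /B; case: (s).
exists (fun i => A (enum_val i)), (fun i => B (enum_val i)).
split=> [i j ij|v /hsupp[u ->]].
  rewrite !eE /e inner_prodv ha; have := inj_eq enum_val_inj i j.
  case: (enum_val i) (enum_val j) => [x1 x2] [y1 y2] /=.
  rewrite (negbTE ij) xpair_eqE; case: eqP => [->|_ _]; rewrite ?mul0r //.
  by rewrite hb => /= ->; rewrite mulr0.
exists (fun i => inner (e (enum_val i)) (X k *m u)).
under eq_bigr => i _ do rewrite eE.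
rewrite -(big_enum_val (fun x => inner (e x) (X k *m u) *: e x)) /=.
rewrite -{1}[X k *m u]mul1mx -(prodv_basis s ha hb) pair_big /= mulmx_suml.
rewrite (bigID (mem F)) /= [X in _ + X]big1 ?addr0 => [|x]; last first.
  by rewrite inE => fx; rewrite -mulmxA [X in _ *m X]mulmxA hX // mul0mx mulmx0.
apply: eq_bigr => x _.
by rewrite -mulmxA inner_adjmx mul_mx_scalar.
Qed.

Lemma exists_orth_prod_cover (rho : 'M[C]_(2 * 2)) :
  density rho -> exists m, orth_prod_cover rho m.
Proof.
case=> hr [pr _]; have [X _ hX] := psd_factor hr pr.
have [|s [a [b [f [ha hb hf]]]]] := @local_labelling_le1 C 1 _ (fun=> X); first by [].
eexists; apply: (@local_labelling_cover 1 _ (fun=> X) s a b f 0) => // [i j|v /hX //].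
exact: hf.
Qed.

(** [epsilon] meets its specification once a minimum is known to exist. Excluded middle makes the
    cover property boolean, and [ex_minnP] then finds its least instance. *)
Lemma Sch_perpP (rho : 'M[C]_(2 * 2)) : density rho ->
  orth_prod_cover rho (Sch_perp rho)
  /\ forall k, orth_prod_cover rho k -> (Sch_perp rho <= k)%N.
Proof.
move=> /exists_orth_prod_cover[m0 hm0]; 
apply: (epsilon_spec (inhabits 0%N) (fun m => orth_prod_cover rho m /\
  forall k, orth_prod_cover rho k -> (m <= k)%N)).
pose P m : bool := excluded_middle_informative (orth_prod_cover rho m).
have PP m : reflect (orth_prod_cover rho m) (P m).
  by rewrite /P; case: excluded_middle_informative => h; constructor.
have exP : exists m, P m by exists m0; apply/PP.
case: (ex_minnP exP) => m /PP hm hmin.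
by exists m; split=> // k /PP/hmin.
Qed.

(** The basis vectors labelled [k] cover [rho k], and each of the four basis vectors has a single
    label, so it is counted at most once. *)
Lemma local_labelling_Sch_perp N (rho X : 'I_N -> 'M[C]_(2 * 2)) :
  (forall k, density (rho k)) ->
  (forall k v, in_supp (rho k) v -> exists u, v = X k *m u) ->
  local_labelling X -> (\sum_(k < N) Sch_perp (rho k) <= 4)%N.
Proof.
move=> hd hX [s [a [b [f [ha hb hf]]]]].
pose F (k : 'I_N) := [set x : 'I_2 * 'I_2 | f x.1 x.2 == k].
apply: (@leq_trans (\sum_(k < N) #|F k|)).
  apply: leq_sum => k _; apply: (Sch_perpP (hd k)).2.
  by apply: (local_labelling_cover ha hb) (hX k) => i j; apply: hf.
have -> : 4%N = (\sum_(x : 'I_2 * 'I_2) 1)%N by rewrite sum1_card card_prod card_ord.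
under eq_bigr do rewrite -sum1dep_card big_mkcond.
rewrite exchange_big /=; apply: leq_sum => x _; rewrite -big_mkcond /= sum1dep_card.
apply/card_le1_eqP => k l; rewrite !inE => /eqP fk /eqP fl.
by apply: val_inj; rewrite /= -fl.
Qed.

End Support.

(** * Triangle-free relations on four points *)

Lemma monochromatic_path_K4 (A B : rel 'I_4) :
  (forall i j, i != j -> A i j || B i j) -> symmetric A -> symmetric B ->
  (forall i j k, A i j -> A j k -> ~~ A i k) ->
  (forall i j k, B i j -> B j k -> ~~ B i k) ->
  exists (s : bool) (i j k l : 'I_4), let R := if s then A else B in
    [/\ i != k, j != l, R i j, R j k & R k l].
Proof.
move=> AB As Bs A3 B3.
pose x0 : 'I_4 := @Ordinal 4 0 isT; pose x1 : 'I_4 := @Ordinal 4 1 isT.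
pose x2 : 'I_4 := @Ordinal 4 2 isT; pose x3 : 'I_4 := @Ordinal 4 3 isT.
have triA i j k : A i j -> A j k -> A i k -> False.
  by move=> ij jk; apply/negP/(A3 _ _ _ ij jk).
have triB i j k : B i j -> B j k -> B i k -> False.
  by move=> ij jk; apply/negP/(B3 _ _ _ ij jk).
(* Each of the six edges picks a relation that holds on it. In all 64 cases one relation contains a
   triangle, which is excluded, or a path through all four points. *)
case/orP: (AB x0 x1 isT) => e01; case/orP: (AB x0 x2 isT) => e02;
case/orP: (AB x0 x3 isT) => e03; case/orP: (AB x1 x2 isT) => e12;
case/orP: (AB x1 x3 isT) => e13; case/orP: (AB x2 x3 isT) => e23;
  first
  [ by case: (triA _ _ _ e01 e12 e02) | by case: (triA _ _ _ e01 e13 e03)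
  | by case: (triA _ _ _ e02 e23 e03) | by case: (triA _ _ _ e12 e23 e13)
  | by case: (triB _ _ _ e01 e12 e02) | by case: (triB _ _ _ e01 e13 e03)
  | by case: (triB _ _ _ e02 e23 e03) | by case: (triB _ _ _ e12 e23 e13)
  | by exists true, x0, x1, x2, x3; split=> //; rewrite As
  | by exists true, x0, x1, x3, x2; split=> //; rewrite As
  | by exists true, x0, x2, x1, x3; split=> //; rewrite As
  | by exists true, x0, x2, x3, x1; split=> //; rewrite As
  | by exists true, x0, x3, x1, x2; split=> //; rewrite As
  | by exists true, x0, x3, x2, x1; split=> //; rewrite As
  | by exists true, x1, x0, x2, x3; split=> //; rewrite As
  | by exists true, x1, x0, x3, x2; split=> //; rewrite As
  | by exists true, x1, x2, x0, x3; split=> //; rewrite As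
  | by exists true, x1, x3, x0, x2; split=> //; rewrite As
  | by exists true, x2, x0, x1, x3; split=> //; rewrite As
  | by exists true, x2, x1, x0, x3; split=> //; rewrite As
  | by exists false, x0, x1, x2, x3; split=> //; rewrite Bs
  | by exists false, x0, x1, x3, x2; split=> //; rewrite Bs
  | by exists false, x0, x2, x1, x3; split=> //; rewrite Bs
  | by exists false, x0, x2, x3, x1; split=> //; rewrite Bs
  | by exists false, x0, x3, x1, x2; split=> //; rewrite Bs
  | by exists false, x0, x3, x2, x1; split=> //; rewrite Bs
  | by exists false, x1, x0, x2, x3; split=> //; rewrite Bs
  | by exists false, x1, x0, x3, x2; split=> //; rewrite Bs
  | by exists false, x1, x2, x0, x3; split=> //; rewrite Bs
  | by exists false, x1, x3, x0, x2; split=> //; rewrite Bs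
  | by exists false, x2, x0, x1, x3; split=> //; rewrite Bs
  | by exists false, x2, x1, x0, x3; split=> //; rewrite Bs ].
Qed.

(** A path [i], [j], [k], [l] in one relation closes to a 4-cycle. Its diagonals would create
    triangles, so they belong to the other relation; they form the two rows of [g]. *)
Lemma four_cycle_K4 (A B : rel 'I_4) :
  (forall i j, i != j -> A i j || B i j) -> symmetric A -> symmetric B ->
  (forall i j k, A i j -> A j k -> ~~ A i k) ->
  (forall i j k, B i j -> B j k -> ~~ B i k) ->
  (forall i j k l, A i j -> A j k -> A k l -> A i l) ->
  (forall i j k l, B i j -> B j k -> B k l -> B i l) ->
  exists (s : bool) (g : 'I_2 -> 'I_2 -> 'I_4),
    (forall i j, (if s then A else B) (g 0 i) (g 1 j)) /\
    (forall i, (if s then B else A) (g i 0) (g i 1)).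
Proof.
move=> AB As Bs A3 B3 A4 B4.
have [s [i [j [k [l [ik jl ij jk kl]]]]]] := monochromatic_path_K4 AB As Bs A3 B3.
exists s, (pair_fun (pair_fun i k) (pair_fun j l)).
set R := (if s then A else B) in ij jk kl *; set S := if s then B else A.
have RS x y : x != y -> ~~ R x y -> S x y.
  by move=> /AB; rewrite /R /S; case: (s); case: (A x y); case: (B x y).
have Rs : symmetric R by rewrite /R; case: (s).
have R3 x y z : R x y -> R y z -> ~~ R x z by rewrite /R; case: (s); [apply: A3 | apply: B3].
have R4 x y z w : R x y -> R y z -> R z w -> R x w.
  by rewrite /R; case: (s); [apply: A4 | apply: B4].
split; last by apply: ord2_ind; [exact: RS (R3 _ _ _ ij jk) | exact: RS (R3 _ _ _ jk kl)].
apply: ord2_ind; apply: ord2_ind; rewrite /pair_fun //=; first exact: R4 ij jk kl.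
by rewrite Rs.
Qed.

(** * Labellings built from one or two product vectors *)

Section Labelling.
Variable C : numClosedFieldType.

(** In dimension two the orthogonal complement of [y] is a line, spanned by [x]. *)
Lemma orth_orth_parallel (x y z : 'cV[C]_2) : x != 0 -> y != 0 ->
  inner x y = 0 -> inner y z = 0 -> exists c, z = c *: x.
Proof.
move=> x0 y0 xy yz.
have [|a [c [ha c0 hac]]] := @onb_normalize C (pair_fun x y) _ xy.
  exact: ord2_ind.
exists (inner (a 0) z * c 0); rewrite -scalerA -(hac 0).
rewrite -{1}[z]mul1mx -(onb_sum_proj ha) big_ord2 mulmxDl -!mulmxA !inner_adjmx.
rewrite !mul_mx_scalar [in X in _ + X](hac 1) innerZl [inner (pair_fun _ _ 1) _]yz.
by rewrite mulr0 scale0r addr0.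
Qed.

Lemma orth_triangle_free (x y z : 'cV[C]_2) : x != 0 -> y != 0 -> z != 0 ->
  inner x y == 0 -> inner y z == 0 -> inner x z != 0.
Proof.
move=> x0 y0 z0 /eqP xy /eqP yz.
have [c zc] := orth_orth_parallel x0 y0 xy yz.
rewrite zc innerZr mulf_eq0 negb_or (gt_eqF (inner_gt0 x0)) andbT.
by apply: contra z0 => /eqP c0; rewrite zc c0 scale0r.
Qed.

(** [z] is a nonzero multiple of [x], so both are orthogonal to the same vectors. *)
Lemma orth_path_closed (x y z w : 'cV[C]_2) : x != 0 -> y != 0 -> z != 0 ->
  inner x y == 0 -> inner y z == 0 -> inner z w == 0 -> inner x w == 0.
Proof.
move=> x0 y0 z0 /eqP xy /eqP yz.
have [c zc] := orth_orth_parallel x0 y0 xy yz.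
rewrite zc innerZl mulf_eq0 fmorph_eq0 => /orP[/eqP c0|//].
by rewrite zc c0 scale0r eqxx in z0.
Qed.

(** Passes orthogonality from a rank-one matrix to the vector spanning its columns: [c] is nonzero,
    so multiplying by it turns [adjmx c] into a positive scalar. *)
Lemma orth_of_factor m n r (Y : 'M[C]_(m, n)) (Z : 'M[C]_(m, r))
    (p : 'cV[C]_m) (c : 'rV[C]_n) :
  Y != 0 -> Y = p *m c -> adjmx Y *m Z = 0 -> adjmx p *m Z = 0.
Proof.
move=> Y0 Yp; rewrite Yp adjmxM -mulmxA => h.
have c0 : c != 0 by apply: contra Y0 => /eqP c0; rewrite Yp c0 mulmx0.
have cc0 : adjmx c != 0 by apply: contra c0 => /eqP e; rewrite -[c]adjmxK e adjmx0.
have := congr1 (mulmx c) h; rewrite mulmx0 mulmxA -{1}[c]adjmxK inner_adjmx.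
rewrite mul_scalar_mx => /eqP; rewrite scaler_eq0 (gt_eqF (inner_gt0 cc0)).
by move=> /= /eqP.
Qed.

Variables (N n : nat) (X : 'I_N -> 'M[C]_(2 * 2, n)).

Lemma local_labelling_of_prodv s (u : 'I_2 -> 'cV[C]_2)
    (v : 'I_2 -> 'I_2 -> 'cV[C]_2) (f : 'I_2 -> 'I_2 -> nat) :
  (forall i, u i != 0) -> (forall i j, v i j != 0) ->
  inner (u 0) (u 1) = 0 -> (forall i, inner (v i 0) (v i 1) = 0) ->
  (forall i j (k : 'I_N), f i j != k -> adjmx (prodv s (u i) (v i j)) *m X k = 0) ->
  local_labelling X.
Proof.
move=> u0 v0 uu vv hX; have [a [c [ha _ hac]]] := onb_normalize u0 uu.
have [b0 [c0 [hb0 _ hbc0]]] := onb_normalize (v0 0) (vv 0).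
have [b1 [c1 [hb1 _ hbc1]]] := onb_normalize (v0 1) (vv 1).
exists s, a, (pair_fun b0 b1), f; split=> // [|i j k fk]; first exact: ord2_ind.
have -> : pair_fun b0 b1 i j = pair_fun c0 c1 i j *: v i j.
  by move: i {fk}; apply: ord2_ind; rewrite /pair_fun /=.
by rewrite hac prodvZl prodvZr scalerA adjmxZ -scalemxAl hX ?scaler0.
Qed.

Hypothesis X_orth : forall k l, k != l -> adjmx (X k) *m X l = 0.

(** Complete [a] and [b] by [perp] to a product basis. The vector built from [a] and [b] is labelled
    [k0]; the other three, orthogonal to [X k0], are labelled [l]. *)
Lemma local_labelling_one_product (k0 l : 'I_N) a b c :
  (forall k, k != l -> k = k0) -> X k0 != 0 -> X k0 = prodv true a b *m c ->
  local_labelling X.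
Proof.
move=> kl Xk0 Xk.
have /prodv_neq0[a0 b0] : prodv true a b != 0.
  by apply: contra Xk0 => /eqP p0; rewrite Xk p0 mul0mx.
apply: (@local_labelling_of_prodv true (pair_fun a (perp a))
    (fun=> pair_fun b (perp b))
    (fun i j => if (i == 0) && (j == 0) then nat_of_ord k0 else nat_of_ord l)).
- by apply: ord2_ind => //; apply: perp_neq0.
- by move=> i; apply: ord2_ind => //; apply: perp_neq0.
- exact: inner_perp.
- by move=> i; apply: inner_perp.
move=> i j k; case: ifPn => [/andP[/eqP -> /eqP ->] kk0|ij lk].
  by apply: orth_of_factor Xk (X_orth _).
rewrite (kl k) 1?eq_sym // Xk mulmxA inner_adjmx inner_prodv.
suff -> : inner (pair_fun a (perp a) i) a * inner (pair_fun b (perp b) j) b = 0.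
  by rewrite raddf0 mul0mx.
have pp w : inner (perp w) w = 0 by rewrite -inner_conj inner_perp conjC0.
by move: i j ij {lk}; apply: ord2_ind; apply: ord2_ind;
  rewrite /pair_fun //= !pp ?mulr0 ?mul0r.
Qed.

(** The factors [u] on one side are orthogonal. Replacing each opposite factor [v i] by [perp (v i)]
    gives two vectors orthogonal to all [X m] with [m != l]; they are labelled [l]. *)
Lemma local_labelling_two_products (k : 'I_2 -> 'I_N) (l : 'I_N)
    (a b : 'I_2 -> 'cV[C]_2) :
  (forall i, prodv true (a i) (b i) != 0) ->
  inner (prodv true (a 0) (b 0)) (prodv true (a 1) (b 1)) = 0 ->
  (forall i m, k i != m -> adjmx (prodv true (a i) (b i)) *m X m = 0) ->
  (forall m, m != l -> exists c : 'I_2 -> 'rV[C]_n,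
     X m = \sum_i prodv true (a i) (b i) *m c i) ->
  local_labelling X.
Proof.
move=> p0 pp pX Xsum.
have [s [u [v [pE uu]]]] : exists s u v,
    (forall i, prodv true (a i) (b i) = prodv s (u i) (v i)) /\ inner (u 0) (u 1) = 0.
  move: pp; rewrite inner_prodv => /eqP; rewrite mulf_eq0 => /orP[]/eqP h.
    by exists true, a, b.
  by exists false, b, a.
have uv i : u i != 0 /\ v i != 0 by apply: (@prodv_neq0 _ s); rewrite -pE.
apply: (@local_labelling_of_prodv s u (fun i => pair_fun (v i) (perp (v i)))
    (fun i => pair_fun (nat_of_ord (k i)) (nat_of_ord l))) => // [i|i|i|i j m].
- by case: (uv i).
- by apply: ord2_ind; rewrite /pair_fun /=; case: (uv i) => // _; apply: perp_neq0.
- exact: inner_perp.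
move: j; apply: ord2_ind => [km|lm]; rewrite /pair_fun /=.
  by rewrite -pE; apply: pX.
have [|c ->] := Xsum m; first by rewrite eq_sym.
rewrite mulmx_sumr big1 // => i' _; rewrite mulmxA pE inner_adjmx inner_prodv.
suff -> : inner (u i) (u i') * inner (perp (v i)) (v i') = 0 by rewrite raddf0 mul0mx.
have pv w : inner (perp w) w = 0 :> C by rewrite -inner_conj inner_perp conjC0.
move: i i' {lm}; apply: ord2_ind; apply: ord2_ind;
  rewrite ?pv ?mulr0 ?uu ?mul0r //.
by rewrite -inner_conj uu conjC0 mul0r.
Qed.

End Labelling.

(** * From the Schmidt bound to a labelling *)

Section SchmidtBound.
Variable C : numClosedFieldType.

(** Along the 4-cycle of [four_cycle_K4] the leading factors take two orthogonal directions, one for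
    each diagonal; within a diagonal the other factors are orthogonal. *)
Lemma local_labelling_four_products n (X : 'I_4 -> 'M[C]_(2 * 2, n))
    (a b : 'I_4 -> 'cV[C]_2) :
  (forall i, prodv true (a i) (b i) != 0) ->
  (forall i j, i != j -> inner (prodv true (a i) (b i)) (prodv true (a j) (b j)) = 0) ->
  (forall i k, i != k -> adjmx (prodv true (a i) (b i)) *m X k = 0) ->
  local_labelling X.
Proof.
move=> p0 pp pX.
have a0 i : a i != 0 by case: (prodv_neq0 (p0 i)).
have b0 i : b i != 0 by case: (prodv_neq0 (p0 i)).
pose orth (w : 'I_4 -> 'cV[C]_2) : rel 'I_4 := fun i j => inner (w i) (w j) == 0.
have orthC w : symmetric (orth w).
  by move=> i j; rewrite /orth -inner_conj fmorph_eq0.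
have [|//|//|||||s [g [hg1 hg2]]] := @four_cycle_K4 (orth a) (orth b).
- by move=> i j ij; rewrite -mulf_eq0 -(inner_prodv true) pp.
- by move=> i j k; apply: orth_triangle_free.
- by move=> i j k; apply: orth_triangle_free.
- by move=> i j k l; apply: orth_path_closed.
- by move=> i j k l; apply: orth_path_closed.
pose u := if s then a else b; pose v := if s then b else a.
have u0 i : u i != 0 by rewrite /u; case: (s).
have v0 i : v i != 0 by rewrite /v; case: (s).
have pE i : prodv true (a i) (b i) = prodv s (u i) (v i) by rewrite /u /v; case: (s).
have uu i j : inner (u (g 0 i)) (u (g 1 j)) = 0.
  by apply/eqP; move: (hg1 i j); rewrite /u; case: (s).
have vv i : inner (v (g i 0)) (v (g i 1)) = 0.
  by apply/eqP; move: (hg2 i); rewrite /v; case: (s).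
(* Both vectors are orthogonal to one vector of the other diagonal. *)
have u_par i j : exists c, u (g i 0) = c *: u (g i j).
  move: i; apply: ord2_ind.
    apply: (@orth_orth_parallel _ _ (u (g 1 0))) => //.
    by rewrite -inner_conj uu conjC0.
  apply: (@orth_orth_parallel _ _ (u (g 0 0))) => //.
  by rewrite -inner_conj uu conjC0.
apply: (@local_labelling_of_prodv _ _ _ X s (fun i => u (g i 0))
    (fun i j => v (g i j)) (fun i j => nat_of_ord (g i j))) => // i j k gk.
have [c ->] := u_par i j.
by rewrite prodvZl adjmxZ -scalemxAl -pE pX ?scaler0.
Qed.

Lemma adjmx_localmx s (E : 'M[C]_2) : adjmx (localmx s E) = localmx s (adjmx E).
Proof. by rewrite /localmx; case: s; rewrite adjmx_tens adjmx1. Qed.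

Lemma local_labelling_pure_pair n (X : 'I_2 -> 'M[C]_(2 * 2, n))
    (psi : 'I_2 -> 'cV[C]_(2 * 2)) (c : 'I_2 -> 'rV[C]_n) :
  (forall k, X k = psi k *m c k) -> inner (psi 0) (psi 1) = 0 ->
  local_labelling X.
Proof.
move=> hX psi01.
pose L (E : 'M[C]_2) := (adjmx (psi 0) *m localmx true E *m psi 1) 0 0.
have Llin (I : finType) (d : I -> C) (E : I -> 'M[C]_2) :
    L (\sum_i d i *: E i) = \sum_i d i * L (E i).
  rewrite /L linear_sum mulmx_sumr mulmx_suml summxE; apply: eq_bigr => i _.
  by rewrite linearZ /= -scalemxAr -scalemxAl mxE.
(* The partial trace of [psi 1 *m adjmx (psi 0)] over Bob: its trace is [inner (psi 0) (psi 1)], and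
   its diagonal entries in the basis [a] are the [L (a i *m adjmx (a i))]. *)
pose M := \matrix_(j, i) L (delta_mx i j).
have [|a ha aM] := @traceless_onb C M.
  transitivity (L 1%:M); last by rewrite /L localmx1 mulmx1 -/(inner _ _) psi01.
  rewrite -diag_const_mx diag_mx_sum_delta Llin; apply: eq_bigr => i _.
  by rewrite !mxE mul1r.
have La i : adjmx (psi 0) *m localmx true (a i *m adjmx (a i)) *m psi 1 = 0.
  rewrite [LHS]mx11_scalar -/(L _) [a i *m _]matrix_sum_delta pair_big /= Llin.
  rewrite -[RHS](aM i) [RHS]mx11_scalar; congr (_%:M).
  rewrite mxE; under [RHS]eq_bigr => r _ do rewrite mxE mulr_suml.
  rewrite pair_big; apply: eq_bigr => -[r t] _ /=.
  by rewrite !mxE big_ord1 !mxE; ring.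
apply: (@local_labelling_of_onb _ _ _ X true a ha) => i k l kl.
rewrite !hX adjmxM -!mulmxA.
suff /(congr1 (fun M => adjmx (c k) *m (M *m c l))) :
    adjmx (psi k) *m localmx true (a i *m adjmx (a i)) *m psi l = 0.
  by rewrite mul0mx mulmx0 !mulmxA.
have Lb : adjmx (psi 1) *m localmx true (a i *m adjmx (a i)) *m psi 0 = 0.
  have := congr1 (@adjmx C 1 1) (La i).
  by rewrite adjmx0 !adjmxM adjmx_localmx adjmxM !adjmxK !mulmxA.
by move: k l kl; apply: ord2_ind; apply: ord2_ind.
Qed.

Lemma rank1_factor m n (X : 'M[C]_(m, n)) : (\rank X <= 1)%N ->
  exists (p : 'cV[C]_m) (c : 'rV[C]_n), X = p *m c.
Proof.
rewrite -{2}[X]mulmx_base; move: (\rank X) (col_base X) (row_base X).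
case=> [|[|//]] P Q _; last by exists P, Q.
by exists 0, 0; rewrite mulmx0 [Q]flatmx0 mulmx0.
Qed.

Lemma orth_prod_cover_factor n (rho : 'M[C]_(2 * 2)) (X : 'M[C]_(2 * 2, n)) m :
  orth_prod_cover rho m -> (forall u, in_supp rho (X *m u)) ->
  exists (a b : 'I_m -> 'cV[C]_2) (c : 'I_m -> 'rV[C]_n),
    (forall i j, i != j -> inner (prodv true (a i) (b i)) (prodv true (a j) (b j)) = 0)
    /\ X = \sum_i prodv true (a i) (b i) *m c i.
Proof.
case=> a [b [hab hc]] hX; exists a, b.
have /fin_all_exists[c cP] : forall j : 'I_n, exists c : 'I_m -> C,
    col j X = \sum_i c i *: prodv true (a i) (b i).
  by move=> j; apply: hc; rewrite colE.
exists (fun i => \row_j c j i); split=> //; apply/matrixP => x y.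
have /matrixP/(_ x 0) := cP y; rewrite mxE => ->; rewrite !summxE.
by apply: eq_bigr => i _; rewrite [RHS]mxE big_ord1 !mxE mulrC.
Qed.

(** By its rank, [X k] has the whole plane of the two product vectors as column space. So these are
    orthogonal to the other state, and both can be labelled [k]. *)
Lemma local_labelling_rank2 n (X : 'I_2 -> 'M[C]_(2 * 2, n)) (k l : 'I_2)
    (a b : 'I_2 -> 'cV[C]_2) (c : 'I_2 -> 'rV[C]_n) :
  (forall k l, k != l -> adjmx (X k) *m X l = 0) ->
  k != l -> (1 < \rank (X k))%N ->
  inner (prodv true (a 0) (b 0)) (prodv true (a 1) (b 1)) = 0 ->
  X k = \sum_i prodv true (a i) (b i) *m c i -> local_labelling X.
Proof.
move=> X_orth kl rk pp Xk.
pose p i := prodv true (a i) (b i).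
pose P : 'M[C]_(2 * 2, 2) := \matrix_(x, i) p i x 0.
pose Q : 'M[C]_(2, n) := \matrix_i c i.
have colP i : col i P = p i by apply/matrixP => x y; rewrite !mxE [y]ord1.
have XPQ : X k = P *m Q.
  rewrite Xk; apply/matrixP => x y; rewrite summxE mxE; apply: eq_bigr => i _.
  by rewrite mxE big_ord1 [P _ _]mxE [Q _ _]mxE.
(* The left inverse of [P] shows that the product vectors are nonzero; the right inverse of [Q]
   writes them as combinations of columns of [X k]. *)
have /row_fullP[P' PP] : row_full P.
  rewrite /row_full eqn_leq rank_leq_col (leq_trans rk) //.
  by rewrite XPQ mxrankM_maxl.
have /row_freeP[Q' QQ] : row_free Q.
  rewrite /row_free eqn_leq rank_leq_row (leq_trans rk) //.
  by rewrite XPQ mxrankM_maxr.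
have P_X : P = X k *m Q' by rewrite XPQ -mulmxA QQ mulmx1.
apply: (@local_labelling_two_products _ _ _ X (fun=> k) l a b) => //.
- move=> i; rewrite -/(p i) -colP colE; apply/eqP => /(congr1 (mulmx P')).
  rewrite mulmxA PP mul1mx mulmx0 => /matrixP/(_ i 0)/eqP.
  by rewrite !mxE !eqxx oner_eq0.
- move=> i m km; rewrite -/(p i) -colP colE P_X !adjmxM -!mulmxA X_orth //.
  by rewrite !mulmx0.
move=> m ml; exists c.
have -> : m = k by move: m k l ml kl {rk Xk XPQ P_X}; do 3! apply: ord2_ind.
by [].
Qed.

End SchmidtBound.

Lemma Sch_perp_local_labelling (C : numClosedFieldType) N
    (rho X : 'I_N -> 'M[C]_(2 * 2)) :
  (forall k, density (rho k)) -> (forall k, X k != 0) ->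
  (forall k l, k != l -> adjmx (X k) *m X l = 0) ->
  (forall k u, in_supp (rho k) (X k *m u)) ->
  (\sum_(k < N) Sch_perp (rho k) <= 4)%N -> local_labelling X.
Proof.
move=> hd X0 X_orth hX.
have fac k m : Sch_perp (rho k) = m ->
    exists (a b : 'I_m -> 'cV[C]_2) (c : 'I_m -> 'rV[C]_(2 * 2)),
    (forall i j, i != j -> inner (prodv true (a i) (b i)) (prodv true (a j) (b j)) = 0)
    /\ X k = \sum_i prodv true (a i) (b i) *m c i.
  by move=> <-; apply: orth_prod_cover_factor (hX k); case: (Sch_perpP (hd k)).
have one k : Sch_perp (rho k) = 1%N -> exists a b c, X k = prodv true a b *m c.
  by move=> /fac[a [b [c [_ ->]]]]; exists (a 0), (b 0), (c 0); rewrite big_ord1.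
have S_gt0 k : (0 < Sch_perp (rho k))%N.
  rewrite lt0n; apply/eqP => /fac[a [b [c [_ Xk]]]].
  by move: (X0 k); rewrite Xk big_ord0 eqxx.
have p_neq0 k a b c : X k = prodv true a b *m c -> prodv true a b != 0.
  by move=> Xk; apply: contra (X0 k) => /eqP p0; rewrite Xk p0 mul0mx.
have NS : (N <= \sum_(k < N) Sch_perp (rho k))%N.
  by rewrite -[X in (X <= _)%N]card_ord -sum1_card leq_sum.
move=> S4; have {NS} N4 := leq_trans NS S4.
case: N rho X hd X0 X_orth hX fac one S_gt0 p_neq0 S4 N4 => [|[|[|[|[|//]]]]] rho X hd
  X0 X_orth hX fac one S_gt0 p_neq0 S4 _.
- exact: local_labelling_le1.
- exact: local_labelling_le1.
- move: S4; rewrite big_ord2.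
  have [/one[a [b [c Xk]]] _|S0] := eqVneq (Sch_perp (rho 0)) 1%N.
    apply: (local_labelling_one_product X_orth (k0 := 0) (l := 1)) Xk => //.
    exact: ord2_ind.
  have [/one[a [b [c Xk]]] _|S1 S4] := eqVneq (Sch_perp (rho 1)) 1%N.
    apply: (local_labelling_one_product X_orth (k0 := 1) (l := 0)) Xk => //.
    exact: ord2_ind.
  (* Both numbers are now 2: either one of the states has rank two, or both are pure. *)
  have := S_gt0 0; have := S_gt0 1 => S_1 S_0.
  have /fac[a0 [b0 [c0 [pp0 Xk0]]]] : Sch_perp (rho 0) = 2%N by lia.
  have /fac[a1 [b1 [c1 [pp1 Xk1]]]] : Sch_perp (rho 1) = 2%N by lia.
  have [r0|r0] := ltnP 1 (\rank (X 0)).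
    exact: (local_labelling_rank2 X_orth (k := 0) (l := 1) _ r0 (pp0 0 1 isT) Xk0).
  have [r1|r1] := ltnP 1 (\rank (X 1)).
    exact: (local_labelling_rank2 X_orth (k := 1) (l := 0) _ r1 (pp1 0 1 isT) Xk1).
  have [psi0 [d0 Xd0]] := rank1_factor r0; have [psi1 [d1 Xd1]] := rank1_factor r1.
  apply: (@local_labelling_pure_pair _ _ X (pair_fun psi0 psi1) (pair_fun d0 d1)).
    exact: ord2_ind.
  have /adjmx_mulCmx h : adjmx psi0 *m X 1 = 0.
    by apply: orth_of_factor Xd0 (X_orth 0 1 isT).
  by rewrite -inner_conj (inner_eq0 (orth_of_factor (X0 1) Xd1 h)) conjC0.
(* Three positive numbers of sum at most 4 include two equal to 1. Their product vectors keep their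
   own labels and the complement is labelled [l]. *)
- have three (k0 k1 l : 'I_3) : k0 != k1 -> k0 != l -> k1 != l ->
      Sch_perp (rho k0) = 1%N -> Sch_perp (rho k1) = 1%N -> local_labelling X.
    move=> k01 k0l k1l /one[a0 [b0 [c0 Xk0]]] /one[a1 [b1 [c1 Xk1]]].
    have pX0 m : k0 != m -> adjmx (prodv true a0 b0) *m X m = 0.
      by move=> km; apply: orth_of_factor Xk0 (X_orth _ _ km).
    have pX1 m : k1 != m -> adjmx (prodv true a1 b1) *m X m = 0.
      by move=> km; apply: orth_of_factor Xk1 (X_orth _ _ km).
    apply: (@local_labelling_two_products _ _ _ X (pair_fun k0 k1) l
      (pair_fun a0 a1) (pair_fun b0 b1)).
    + by apply: ord2_ind; [apply: p_neq0 Xk0 | apply: p_neq0 Xk1].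
    + by rewrite -inner_conj (inner_eq0
        (orth_of_factor (X0 k1) Xk1 (adjmx_mulCmx (pX0 _ k01)))) conjC0.
    + exact: ord2_ind.
    move=> m ml; have [->|m0] := eqVneq m k0.
      by exists (pair_fun c0 0); rewrite big_ord2 /pair_fun /= mulmx0 addr0.
    have -> : m = k1.
      apply/eqP; move: k01 k0l k1l ml m0; rewrite -!val_eqE /=.
      by have := ltn_ord m; have := ltn_ord k0; have := ltn_ord k1; have := ltn_ord l; lia.
    by exists (pair_fun 0 c1); rewrite big_ord2 /pair_fun /= mulmx0 add0r.
  pose x0 : 'I_3 := @Ordinal 3 0 isT; pose x1 : 'I_3 := @Ordinal 3 1 isT.
  pose x2 : 'I_3 := @Ordinal 3 2 isT.
  have : (Sch_perp (rho x0) + Sch_perp (rho x1) + Sch_perp (rho x2) <= 4)%N.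
    apply: leq_trans S4; rewrite !big_ord_recr big_ord0 /= add0n.
    by apply: eq_leq; congr (Sch_perp (rho _) + Sch_perp (rho _) + Sch_perp (rho _))%N;
      apply: val_inj.
  have := S_gt0 x0; have := S_gt0 x1; have := S_gt0 x2 => S2 S1 S0 S012.
  have [e0|n0] := eqVneq (Sch_perp (rho x0)) 1%N.
    have [e1|n1] := eqVneq (Sch_perp (rho x1)) 1%N; first exact: (three x0 x1 x2).
    by apply: (three x0 x2 x1) => //; lia.
  by apply: (three x1 x2 x0) => //; lia.
(* Four positive numbers of sum at most 4 all equal 1. *)
- have S1 k : Sch_perp (rho k) = 1%N.
    apply/eqP; rewrite eqn_leq S_gt0 andbT.
    rewrite (bigD1 k) //= in S4.
    have : (\sum_(i < 4 | i != k) 1 <= \sum_(i < 4 | i != k) Sch_perp (rho i))%N.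
      exact: leq_sum.
    rewrite sum1_card cardC1 card_ord /= => h3.
    by rewrite -(leq_add2r 3) (leq_trans _ S4) // leq_add2l.
  have /fin_all_exists[a /fin_all_exists[b /fin_all_exists[c abc]]] := fun k => one k (S1 k).
  have pX i k : i != k -> adjmx (prodv true (a i) (b i)) *m X k = 0.
    by move=> ik; apply: orth_of_factor (abc i) (X_orth _ _ ik).
  apply: (@local_labelling_four_products _ _ X a b) => // [i|i j ij].
    exact: p_neq0 (abc i).
  by rewrite -inner_conj (inner_eq0
    (orth_of_factor (X0 j) (abc j) (adjmx_mulCmx (pX _ _ ij)))) conjC0.
Qed.

Theorem theorem4 (C : numClosedFieldType) (N : nat) (rho : 'I_N -> 'M[C]_(2 * 2))
  (hdens : forall k, density (rho k))
  (horth : forall k l, k != l -> \tr (rho k *m rho l) = 0) :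
  LOCC_perfectly_distinguishable rho <-> (\sum_(k < N) Sch_perp (rho k) <= 4)%N.
Proof.
have /fin_all_exists[X hX] : forall k, exists Xk : 'M[C]_(2 * 2),
    rho k = Xk *m adjmx Xk /\ forall v, in_supp (rho k) v <-> exists u, v = Xk *m u.
  by move=> k; have [hr [pr _]] := hdens k; have [Xk] := psd_factor hr pr; exists Xk.
have X0 k : X k != 0.
  have [_ [_ tr1]] := hdens k; apply/eqP => Xk0; move/eqP: tr1.
  by rewrite (hX k).1 Xk0 mul0mx mxtrace0 eq_sym oner_eq0.
(* [\tr (rho k *m rho l)] is the squared Frobenius norm of [adjmx (X k) *m X l]. *)
have X_orth k l : k != l -> adjmx (X k) *m X l = 0.
  move=> /horth; rewrite (hX k).1 (hX l).1 => h; apply: mxtrace_mulmx_adj_eq0.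
  by rewrite adjmxM adjmxK -h !mulmxA mxtrace_mulC !mulmxA.
split=> [[p [vp hp]]|].
  apply: (local_labelling_Sch_perp (X := X)) => // [k v|]; first by move/(hX k).2.
  apply: LOCC_local_labelling => //; exists p; split=> // k.
  by rewrite -(hX k).1.
move=> S4; have [|p [vp hp]] := @local_labelling_LOCC C N _ X.
  apply: (Sch_perp_local_labelling (rho := rho)) => // k u.
  by apply/(hX k).2; exists u.
by exists p; split=> // k; rewrite (hX k).1.
Qed.
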